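(* A finite semigroup $P$ is strong subsemigroup separability preserving if and only if every element of $P$ is indecomposable or belongs to a subgroup of $P$.
   Context: Semigroups are nonempty; $S\times T$ is the direct product with componentwise multiplication. A semigroup $S$ is strongly subsemigroup separable if for every $s\in S$ and every subsemigroup $Y$ of $S$ with $s\notin Y$ there exist a finite semigroup $Q$ and a semigroup homomorphism $\phi:S\to Q$ with $\phi(s)\notin\phi(Y)$. A semigroup $T$ is strong subsemigroup separability preserving if for every strongly subsemigroup separable semigroup $S$, the direct product $S\times T$ is strongly subsemigroup separable. An element $p$ of a semigroup $P$ is decomposable if $p=tu$ for some $t,u\in P$, and indecomposable otherwise. A subgroup of a semigroup $P$ is a subsemigroup which is a group under the induced multiplication (its identity need not be an identity of $P$). *)

(* Defs.v *)
From mathcomp Require Import all_boot.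
From mathcomp Require Import boolp classical_sets cardinality.

Set Implicit Arguments.
Unset Strict Implicit.
Unset Printing Implicit Defensive.

Local Open Scope classical_set_scope.
Local Open Scope group_scope.

(* A [semigroupType] may be empty, so nonemptiness is always stated separately.
   Its [choiceType] component is no restriction: classically, every type can be
   given one ([boolp.gen_choiceMixin]). *)

Definition finite_semigroup (Q : semigroupType) : Prop :=
  [set: Q] !=set0 /\ finite_set [set: Q].

Definition subsemigroup (S : semigroupType) (Y : set S) : Prop :=
  Y !=set0 /\ forall x y, Y x -> Y y -> Y (x * y).

Definition strongly_subsemigroup_separable (S : semigroupType) : Prop :=
  forall (s : S) (Y : set S), subsemigroup Y -> ~ Y s ->
    exists Q : semigroupType, finite_semigroup Q /\
      exists phi : {multiplicative S -> Q}, ~ (phi @` Y) (phi s).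

(* The componentwise product on [S * T] is the instance from [boot.monoid]. *)
Definition strong_subsemigroup_separability_preserving (T : semigroupType) : Prop :=
  forall S : semigroupType, [set: S] !=set0 ->
    strongly_subsemigroup_separable S ->
    strongly_subsemigroup_separable (S * T)%type.

Definition decomposable (P : semigroupType) (p : P) : Prop :=
  exists t u : P, p = t * u.

Definition indecomposable (P : semigroupType) (p : P) : Prop :=
  ~ decomposable p.

Definition subgroup (P : semigroupType) (G : set P) : Prop :=
  subsemigroup G /\
  exists e : P, G e /\
    forall x, G x -> e * x = x /\ x * e = x /\
      exists y, G y /\ x * y = e /\ y * x = e.

(* Main.v *)
(* A point s is approximated by a set A when no homomorphism to a finite
   semigroup separates s from A; strong subsemigroup separability says that
   every subsemigroup contains the points it approximates.

   Sufficiency.  An indecomposable element is separated from every other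
   element by a two-valued homomorphism to a null semigroup.  Otherwise p lies
   in a subgroup; write Y_q for the slice of Y over q, and suppose that Y_p
   approximates s.  If no power s^k (k >= 2) equals s, then separating s from
   these powers shows that s is separated from any set not containing it.  If
   not, pick m >= 2 with s^(m+1) = s and p^(m+1) = p, and put e = p^m.  Then
   {x in Y_e | x s in Y_p} is a subsemigroup which approximates s^m, as it
   contains y s^(m-1) for every y in Y_p; so it contains s^m, hence
   s = s^m s lies in Y_p.

   Necessity.  If p = t u lies in no subgroup, then no power p^k (k >= 2) equals
   p.  Take S to consist of 0 and x_i, y_i, z_i (i in nat), where x_i y_i = z_i
   and all other products vanish.  The subsemigroup of S * P generated by the
   (z_i, p) misses (0, p), but any homomorphism to a finite semigroup identifies
   some (y_i, u) and (y_j, u), hence also (x_i, t) (y_i, u) = (z_i, p) and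
   (x_i, t) (y_j, u) = (0, p). *)

Require Import Defs.
From HB Require Import structures.
From mathcomp Require Import all_boot.
From mathcomp Require Import boolp classical_sets cardinality.
From mathcomp Require Import zify.

Set Implicit Arguments.
Unset Strict Implicit.
Unset Printing Implicit Defensive.

Local Open Scope classical_set_scope.
Local Open Scope group_scope.

(** * Powers and cyclic subgroups *)

(* Without an identity there is no zeroth power: [spow x n] is x^(n+1). *)
Definition spow (S : semigroupType) (x : S) (n : nat) : S := iter n ( *%g x) x.

Lemma spowS (S : semigroupType) (x : S) n : spow x n.+1 = x * spow x n.
Proof. by []. Qed.

Lemma spowD (S : semigroupType) (x : S) m n :
  spow x m * spow x n = spow x (m + n).+1.
Proof. by elim: m => [//|m IHm]; rewrite spowS -mulgA IHm. Qed.

Lemma spowSr (S : semigroupType) (x : S) n : spow x n.+1 = spow x n * x.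
Proof. by rewrite -[x in RHS]/(spow x 0) spowD addn0. Qed.

Lemma spow_period (S : semigroupType) (x : S) N a b :
  spow x N.+1 = x -> spow x (a + b * N.+1) = spow x a.
Proof.
move=> xN; elim: b => [|b IHb]; first by rewrite addn0.
rewrite mulSn addnCA addnC; case: (a + _)%N IHb => [|c] IHb.
  by rewrite add0n xN.
by rewrite addSn -spowD xN -spowSr.
Qed.

Lemma morph_spow (S T : semigroupType) (f : {multiplicative S -> T}) x n :
  f (spow x n) = spow (f x) n.
Proof. by elim: n => //= n IHn; rewrite gmulfM IHn. Qed.

Lemma spow_pair (S T : semigroupType) (x : S) (y : T) n :
  spow (x, y) n = (spow x n, spow y n).
Proof. by elim: n => //= n; rewrite /spow /= => ->. Qed.

Lemma closed_spow (S : semigroupType) (Y : set S) x n :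
  (forall a b, Y a -> Y b -> Y (a * b)) -> Y x -> Y (spow x n).
Proof. by move=> YM Yx; elim: n => //= n IHn; apply: YM. Qed.

Lemma subgroup_spow (P : semigroupType) (p : P) k :
  spow p k.+1 = p -> subgroup (range (spow p)).
Proof.
move=> pk; split.
  split=> [|_ _ [m _ <-] [n _ <-]]; first by exists p, 0%N.
  by rewrite spowD; exists (m + n).+1.
have period n : spow p (n + k).+1 = spow p n.
  by rewrite -addnS -[k.+1]mul1n spow_period.
exists (spow p k); split=> [|_ [n _ <-]]; first by exists k.
rewrite !spowD addnC period; split=> //; split=> //.
(* The exponents n+1 and (n+2)k+1 add up to (n+2)(k+1), a multiple of the period k+1. *)
exists (spow p (n.+2 * k)); split; first by exists (n.+2 * k)%N.
rewrite !spowD -(spow_period k n.+1 pk).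
by split; congr (spow p _); lia.
Qed.

Lemma finite_collision (T : Type) (f : nat -> T) :
  finite_set [set: T] -> exists i j, i <> j /\ f i = f j.
Proof.
move=> finT; apply: contrapT => noij; apply: infinite_nat.
have injf : {in [set: nat] &, injective f}.
  by move=> i j _ _ fij; apply: contrapT => ij; apply: noij; exists i, j.
by rewrite -(eq_finite_set (inj_card_eq injf)); apply: sub_finite_set finT.
Qed.

Lemma spow_of_subgroup (P : semigroupType) (p : P) (G : set P) :
  finite_set [set: P] -> subgroup G -> G p -> exists k, spow p k.+1 = p.
Proof.
move=> finP [[_ GM] [e [_ eP]]] Gp.
have [_ [_ [y [_ [_ yp]]]]] := eP _ Gp.
have eK n : e * spow p n = spow p n by have [] := eP _ (closed_spow n GM Gp).
(* The inverse [y] of [p] in [G] cancels one factor at a time. *)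
have cancel i d : spow p i = spow p (i + d).+1 -> spow p d.+1 = p.
  elim: i => [/esym//|i IHi] pij; apply: IHi.
  by rewrite -eK -yp -mulgA -spowS pij addSn spowS mulgA yp eK.
have [i [j [ij pij]]] := finite_collision (spow p) finP.
exists (maxn i j - (minn i j).+1)%N; apply: (cancel (minn i j)).
have -> : (minn i j + (maxn i j - (minn i j).+1)).+1 = maxn i j by lia.
by rewrite /minn /maxn; case: ifP.
Qed.

(** * Approximated points *)

Definition approximated (S : semigroupType) (A : set S) (s : S) : Prop :=
  forall Q : semigroupType, finite_semigroup Q ->
  forall phi : {multiplicative S -> Q}, (phi @` A) (phi s).

Lemma strongly_separableP (S : semigroupType) :
  strongly_subsemigroup_separable S <->
  forall (s : S) Y, subsemigroup Y -> approximated Y s -> Y s.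
Proof.
split=> [sepS s Y YS sY|sepS s Y YS Ys].
  apply: contrapT => /(sepS _ _ YS)[Q [finQ [phi]]]; apply; exact: sY.
apply: contrapT => noQ; apply: Ys; apply: sepS YS _ => Q finQ phi.
by apply: contrapT => nphi; apply: noQ; exists Q; split=> //; exists phi.
Qed.

(** The first hypothesis holds for translations and powers, because kernels of homomorphisms are
    congruences. *)
Lemma approximated_map (S : semigroupType) (A B : set S) (g : S -> S) s :
    (forall (Q : semigroupType) (phi : {multiplicative S -> Q}) x y,
      phi x = phi y -> phi (g x) = phi (g y)) ->
    (forall x, A x -> B (g x)) ->
  approximated A s -> approximated B (g s).
Proof.
move=> gP AB As Q finQ phi; have [x Ax xs] := As Q finQ phi.
by exists (g x); [exact: AB | exact: gP].
Qed.

Lemma finite_semigroup_prod (Q R : semigroupType) :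
  finite_semigroup Q -> finite_semigroup R -> finite_semigroup (Q * R)%type.
Proof.
move=> [[q _] finQ] [[r _] finR]; split; first by exists (q, r).
by rewrite -setXTT; apply: finite_setX.
Qed.

(** * The matching semigroup and indecomposable elements *)

(* [Some (Some true, i)], [Some (Some false, i)] and [Some (None, i)] stand for
   x_i, y_i and z_i = x_i y_i; the zero is [None]. *)
Definition matching (I : choiceType) : Type := option (option bool * I).

Section Matching.
Variable I : choiceType.

HB.instance Definition _ := Choice.on (matching I).

Definition matching_x (i : I) : matching I := Some (Some true, i).
Definition matching_y (i : I) : matching I := Some (Some false, i).
Definition matching_z (i : I) : matching I := Some (None, i).

Definition matching_mul (a b : matching I) : matching I :=
  match a, b with
  | Some (Some true, i), Some (Some false, j) =>
      if i == j then matching_z i else None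
  | _, _ => None
  end.

Lemma matching_mulA : associative matching_mul.
Proof.
by move=> [[[[]|] i]|] [[[[]|] j]|] [[[[]|] k]|] //=; case: ifP.
Qed.

HB.instance Definition _ := isSemigroup.Build (matching I) matching_mulA.

End Matching.

Lemma finite_matching_unit : finite_semigroup (matching unit).
Proof.
split; first by exists None.
exact: (@finite_finset (option (option bool * unit))).
Qed.

Section Indicator.
Variables (S : semigroupType) (s : S).
Hypothesis s_indec : indecomposable s.

Definition indicator (x : S) : matching unit :=
  if x == s then matching_z tt else None.

Lemma indicatorM : {morph indicator : x y / x * y}.
Proof.
move=> x y; rewrite /indicator; case: eqP => [xy|_].
  by case: s_indec; exists x, y.
by case: eqP; case: eqP.
Qed.

HB.instance Definition _ := isMultiplicative.Build S (matching unit)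
  indicator indicatorM.

Lemma approximated_indecomposable (A : set S) : approximated A s -> A s.
Proof.
move=> /(_ _ finite_matching_unit (indicator : {multiplicative S -> _}))[x Ax].
by rewrite /= /indicator eqxx; case: eqP => // <-.
Qed.

End Indicator.

(** * Sufficiency *)

(** A set that approximates a point is nonempty, as the constant zero homomorphism shows. *)
Lemma strongly_separable_closed (S : semigroupType) (Y : set S) s :
    strongly_subsemigroup_separable S ->
    (forall x y, Y x -> Y y -> Y (x * y)) ->
  approximated Y s -> Y s.
Proof.
move=> /strongly_separableP sepS YM sY; apply: sepS => //; split=> //.
have zeroM : {morph (fun=> None : matching unit) : x y / (x : S) * y >-> x * y}.
  by [].
pose zero : {multiplicative S -> matching unit} :=
  HB.pack (fun _ : S => None : matching unit)
    (isMultiplicative.Build S (matching unit) _ zeroM).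
by have [x Yx _] := sY _ finite_matching_unit zero; exists x.
Qed.

Lemma approximated_aperiodic (S : semigroupType) (A : set S) s :
    strongly_subsemigroup_separable S -> (forall k, spow s k.+1 <> s) ->
  approximated A s -> A s.
Proof.
move=> sepS sk sA; apply: contrapT => As.
have [] : ~ approximated (range (fun k => spow s k.+1)) s.
  move=> /(strongly_separable_closed sepS)[|k _] //; last exact: sk.
  move=> _ _ [m _ <-] [n _ <-]; rewrite spowD.
  by exists (m.+1 + n.+1)%N.
move=> Q finQ phi; apply: contrapT => phik.
have phis k : phi s <> spow (phi s) k.+1.
  by move=> sE; apply: phik; exists (spow s k.+1); rewrite // morph_spow.
(* Products of two elements of [Z] fall into the second part, so [Z] is closed whatever [A] is; the
   choice of [phi] keeps [s] out of that part. *)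
pose Z := [set x | A x /\ phi x = phi s \/
                   exists k, phi x = spow (phi s) k.+1].
suff [[]|[k /phis]] : Z s by [].
apply: (strongly_separable_closed sepS) => [x y Zx Zy|R finR psi].
  have ZE z : Z z -> exists k, phi z = spow (phi s) k.
    by move=> [[_ ->]|[k ->]]; [exists 0%N | exists k.+1].
  have [[m xE] [n yE]] := (ZE _ Zx, ZE _ Zy).
  by right; exists (m + n)%N; rewrite gmulfM xE yE spowD.
(* Pairing [psi] with [phi] puts the witness from [A] into the fibre of [phi s]. *)
have phipsiM : {morph (fun x => (phi x, psi x)) : x y / x * y}.
  by move=> x y; rewrite !gmulfM.
pose phipsi : {multiplicative S -> Q * R} :=
  HB.pack (fun x => (phi x, psi x)) (isMultiplicative.Build S _ _ phipsiM).
have [x Ax [xphi xpsi]] := sA _ (finite_semigroup_prod finQ finR) phipsi.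
by exists x => //; left.
Qed.

(** Here m = L+2, so [spow s L] is s^(m-1) and [spow s L.+1] is s^m. *)
Lemma approximated_periodic (S P : semigroupType) (Y : set (S * P)%type)
    (s : S) (p : P) L :
    strongly_subsemigroup_separable S ->
    (forall x y, Y x -> Y y -> Y (x * y)) ->
    spow s L.+2 = s -> spow p L.+2 = p ->
  approximated [set x | Y (x, p)] s -> Y (s, p).
Proof.
move=> sepS YM sL pL sY; pose e := spow p L.+1.
have pe : p * e = p by rewrite -spowS pL.
have ep : e * p = p by rewrite -spowSr pL.
have ee : e * e = e by rewrite {2}/e spowS mulgA ep.
have slice q r t x y : Y (x, q) -> Y (y, r) -> q * r = t -> Y (x * y, t).
  by move=> Yx Yy <-; apply: (YM _ _ Yx Yy).
have Y_spow x n : Y (x, p) -> Y (spow x n, spow p n).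
  by rewrite -spow_pair; apply: closed_spow.
have closed_e x : approximated [set x | Y (x, e)] x -> Y (x, e).
  apply: (strongly_separable_closed sepS) => a b Ya Yb.
  exact: slice Ya Yb ee.
have Yf : Y (spow s L.+1, e).
  apply/closed_e; apply: (@approximated_map _ _ _ (fun x => spow x L.+1)) sY.
    by move=> Q phi x y xy; rewrite !morph_spow xy.
  by move=> x Yx; apply: Y_spow.
have Ys y : Y (y, p) -> Y (y * spow s L, e).
  move=> Yy; apply/closed_e.
  apply: (@approximated_map _ _ _ (fun x => y * spow x L)) sY.
    by move=> Q phi x x' xx'; rewrite !gmulfM !morph_spow xx'.
  by move=> x Yx; apply: slice Yy (Y_spow _ L Yx) _.
pose A := [set x | Y (x, e) /\ Y (x * s, p)].
suff [_] : A (spow s L.+1) by rewrite -spowSr sL.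
apply: (strongly_separable_closed sepS) => [x y [Yx Yxs] [Yy Yys]|].
  split; first exact: slice Yx Yy ee.
  by rewrite -mulgA; apply: slice Yx Yys ep.
apply: (@approximated_map _ _ _ (fun x => x * spow s L)) sY.
  by move=> Q phi x y xy; rewrite !gmulfM xy.
move=> y Yy; split; first exact: Ys.
by rewrite -mulgA -spowSr; apply: slice Yy Yf pe.
Qed.

Lemma strongly_separable_prod (S P : semigroupType) :
    finite_semigroup P -> strongly_subsemigroup_separable S ->
    (forall p : P, indecomposable p \/ exists G : set P, subgroup G /\ G p) ->
  strongly_subsemigroup_separable (S * P)%type.
Proof.
move=> finP sepS Pp; apply/strongly_separableP => -[s p] Y [_ YM] spY.
have [p_indec|[G [GP Gp]]] := Pp p.
  apply: approximated_indecomposable spY => -[[x q] [[y r] [_ pE]]].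
  by apply: p_indec; exists q, r.
(* As [P] is finite, [phi] times the identity of [P] has a finite target; it forces the second
   coordinate to be [p]. *)
have sY : approximated [set x | Y (x, p)] s.
  move=> Q finQ phi.
  have phiM : {morph (fun w : S * P => (phi w.1, w.2)) : x y / x * y}.
    by move=> x y; rewrite /= gmulfM.
  pose phi1 : {multiplicative S * P -> Q * P} :=
    HB.pack (fun w : S * P => (phi w.1, w.2))
      (isMultiplicative.Build _ _ _ phiM).
  have [[x q] Yxq [xs qp]] := spY _ (finite_semigroup_prod finQ finP) phi1.
  by exists x; rewrite //= -qp.
have [[k sk]|] := pselect (exists k, spow s k.+1 = s); last first.
  move=> /forallNP sk; exact: (approximated_aperiodic sepS sk sY).
have [d pd] := spow_of_subgroup finP.2 GP Gp.
(* (k+1)(d+1) is a common period of [s] and [p]; doubling it gives the form [L.+2]. *)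
apply: (@approximated_periodic _ _ _ _ _ (k.+1 * d.+1 * 2).-2) sY => //.
  have -> : (k.+1 * d.+1 * 2).-2.+2 = (0 + (d.+1 * 2) * k.+1)%N by lia.
  exact: spow_period.
have -> : (k.+1 * d.+1 * 2).-2.+2 = (0 + (k.+1 * 2) * d.+1)%N by lia.
exact: spow_period.
Qed.

(** * Necessity *)

Section Level.
Variables (I : choiceType) (i : I).

(** This is the Rees quotient by the ideal of zero and all elements of index other than [i]; its
    nonzero values have one-point fibres. *)
Definition level (a : matching I) : matching unit :=
  if a is Some (c, j) then if j == i then Some (c, tt) else None else None.

Lemma levelM : {morph level : x y / x * y}.
Proof.
rewrite /level => -[[[[]|] j]|] [[[[]|] k]|] /=; try by do ?case: ifP.
rewrite /mul /=; case: (eqVneq j k) => [->|jk] /=; first by case: eqP.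
case: (eqVneq j i) jk => [->|] //.
by case: (eqVneq k i) => // ->; rewrite eqxx.
Qed.

HB.instance Definition _ := isMultiplicative.Build (matching I) (matching unit)
  level levelM.

End Level.

(** Zero lies in every subsemigroup, and [level i] isolates each nonzero element of index [i]. *)
Lemma strongly_separable_matching (I : choiceType) :
  strongly_subsemigroup_separable (matching I).
Proof.
apply/strongly_separableP => -[[c i]|] Y [[y0 Yy0] YM] sY; last first.
  have <- : (y0 * y0) * (y0 * y0) = None by case: y0 {Yy0} => [[[[]|] j]|].
  by do 2!apply: (YM).
have [y Yy] := sY _ finite_matching_unit (level i : {multiplicative _ -> _}).
rewrite /= /level eqxx; case: y Yy => [[c' j]|//] Yy.
by case: eqP => // ji [cc]; rewrite -ji -cc.
Qed.

Lemma prod_matching_not_separable (P : semigroupType) (p : P) :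
    decomposable p -> (forall k, spow p k.+1 <> p) ->
  ~ strongly_subsemigroup_separable (matching nat * P)%type.
Proof.
move=> [t [u ptu]] pk /strongly_separableP sepSP.
(* Admitting every first coordinate over p^k for k >= 2 makes closure immediate and still leaves out
   (0, p). *)
pose Y := [set w : matching nat * P |
  (exists i, w = (matching_z i, p)) \/ exists k, w.2 = spow p k.+1].
suff [[]|[k /esym /pk]] : Y (None, p) by [].
apply: sepSP => [|Q [_ finQ] phi].
  split=> [|v w Yv Yw]; first by exists (matching_z 0%N, p); left; exists 0%N.
  have YE x : Y x -> exists k, x.2 = spow p k.
    by move=> [[i ->]|[k ->]]; [exists 0%N | exists k.+1].
  have [[m vE] [n wE]] := (YE _ Yv, YE _ Yw).
  by right; exists (m + n)%N; rewrite -spowD -vE -wE.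
have [i [j [ij yij]]] := finite_collision (fun i => phi (matching_y i, u)) finQ.
exists (matching_z i, p); first by left; exists i.
have zE k l : (matching_x k, t) * (matching_y l, u) =
    (if k == l then matching_z k else None, p) :> matching nat * P.
  by rewrite ptu.
have := zE i i; rewrite eqxx => <-.
by have := zE i j; case: eqP => // _ <-; rewrite !gmulfM yij.
Qed.

Theorem theorem3p5 (P : semigroupType) (finP : finite_semigroup P) :
  strong_subsemigroup_separability_preserving P <->
  (forall p : P, indecomposable p \/ exists G : set P, subgroup G /\ G p).
Proof.
split=> [presP p|Pp S _ sepS]; last exact: strongly_separable_prod.
have [p_dec|] := pselect (decomposable p); last by left.
have [[k pk]|/forallNP pk] := pselect (exists k, spow p k.+1 = p).
  right; exists (range (spow p)).
  by split; [exact: subgroup_spow pk | exists 0%N].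
have [] := prod_matching_not_separable p_dec pk.
by apply: presP; [exists None | exact: strongly_separable_matching].
Qed.
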